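(* Let $q$ be a prime. For any $j\in\mathbb{F}_q^{*}$ and any positive integer $N\le q$, let $T_{2,2}(N;j,q)$ denote the number of quadruples $(b_1,b_2,b_3,b_4)\in\mathbb{F}_q^4$ such that $$b_1+b_2=b_3+b_4 \quad\text{and}\quad b_i^2\in\{j,2j,\ldots,Nj\}\subseteq \mathbb{F}_q,\qquad i=1,2,3,4.$$ Then $$ T_{2,2}(N;j,q)\ll \left(\frac{N^{3/2}}{q^{1/2}}+1\right)N^{2+o(1)}. $$
   Context: $\mathbb{F}_q$ is the field of $q$ elements, $q$ prime; integers are viewed in $\mathbb{F}_q$ by reduction modulo $q$, so $\{j,2j,\ldots,Nj\}$ is a subset of $\mathbb{F}_q$. $U\ll V$ means $|U|\le cV$ for some absolute positive constant $c$. For a quantity $V>1$, $V^{o(1)}$ (as $V\to\infty$) denotes a function $U$ of $V$ satisfying $|U|\le V^{\varepsilon}$ for every $\varepsilon>0$, provided $V$ is large enough in terms of $\varepsilon$; thus the bound means that for every $\varepsilon>0$ there is a constant $C(\varepsilon)$ such that the inequality holds with $C(\varepsilon)N^{2+\varepsilon}$ in place of $N^{2+o(1)}$, uniformly over $q,j,N$. *)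

(* Defs.v *)
From mathcomp Require Import all_boot all_order all_algebra.

Set Implicit Arguments.
Unset Strict Implicit.
Unset Printing Implicit Defensive.

Import GRing.Theory.
Local Open Scope ring_scope.

Definition multiples (q N : nat) (j : 'F_q) : {set 'F_q} :=
  [set n.+1%:R * j | n : 'I_N].

(* 'F_q is the field of q elements only when q is prime; every use of T22
   carries that hypothesis. *)
Definition T22 (q N : nat) (j : 'F_q) : nat :=
  #|[set b : 'F_q * 'F_q * 'F_q * 'F_q |
      let: (b1, b2, b3, b4) := b in
      [&& b1 + b2 == b3 + b4,
          b1 ^+ 2 \in multiples N j, b2 ^+ 2 \in multiples N j,
          b3 ^+ 2 \in multiples N j & b4 ^+ 2 \in multiples N j]]|.

(* Main.v *)
Require Import Defs.
From mathcomp Require Import all_boot all_order all_algebra.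
From mathcomp Require Import boolp reals sequences exp.
From mathcomp Require Import zify ring lra.

Set Implicit Arguments.
Unset Strict Implicit.
Unset Printing Implicit Defensive.

Import Order.TTheory GRing.Theory Num.Theory.
Local Open Scope ring_scope.

(** Write [b1 + b2 = lam], [b_i^2 = j n_i], [mu = lam^2 / j], [d = n1 - n2] and
    [s = n1 + n2]. Then [d^2 + mu^2 = 2 mu s] in [F_q], so the energy is
    controlled by [sum_mu |P_mu|^2], where [P_mu] is the set of points [(n1, n2)]
    of the box on this parabola, while [sum_mu |P_mu| <= 2 N^2]. For two points
    of [P_mu] the vector [(d^2 - d'^2, s - s')] lies in the lattice
    [x = 2 mu y mod q] of determinant [q].
    If two such vectors are not parallel, the lattice has [O(N^3 / q)] points in
    the relevant box; as [d - d'] divides [d^2 - d'^2], the divisor bound gives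
    [|P_mu|^2 <= N^o(1) (|P_mu| + N^3 / q)].
    If all of them are multiples of one vector [(a, b)], then [d^2] is constant
    modulo [a] on [P_mu], and factoring [d^2 - d0^2] bounds [|P_mu|^2] by
    [N^o(1) (1 + sum_(g^2 | a) N g^2 / |a b|)]. Since [mu = a / (2 b)], summing
    over all [(a, b)] contributes [N^(2 + o(1))]. *)

(** * Counting by injections, and reduction of integers modulo [q] *)

Lemma card_le_inj_in (T : finType) (U : eqType) (A : {set T}) (f : T -> U)
    (s : seq U) :
  {in A &, injective f} -> (forall x, x \in A -> f x \in s) ->
  (#|A| <= size s)%N.
Proof.
move=> f_inj fs; rewrite cardE -(size_map f); apply: uniq_leq_size.
  by rewrite map_inj_in_uniq ?enum_uniq // => x y; rewrite !mem_enum; apply: f_inj.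
by move=> _ /mapP [x xA ->]; apply: fs; rewrite mem_enum in xA.
Qed.

Definition int_range (n : nat) : seq int :=
  [seq i%:Z - n%:Z | i <- iota 0 n.*2.+1].

Lemma size_int_range n : size (int_range n) = n.*2.+1.
Proof. by rewrite size_map size_iota. Qed.

Lemma mem_int_range n (z : int) : (z \in int_range n) = (`|z| <= n)%N.
Proof.
apply/mapP/idP => [[i]|zn].
  by rewrite mem_iota => /andP [_ hi] ->; lia.
by exists (`|(z + n%:Z)%R|%N); rewrite ?mem_iota; lia.
Qed.

Lemma size_le_box (U : eqType) (s : seq U) (f g : U -> int) (m n : nat) :
  uniq s -> {in s &, injective (fun x => (f x, g x))} ->
  (forall x, x \in s -> (`|f x| <= m)%N && (`|g x| <= n)%N) ->
  (size s <= m.*2.+1 * n.*2.+1)%N.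
Proof.
move=> s_uniq inj_fg bnd; pose h x := (f x, g x).
rewrite -!size_int_range -(size_allpairs pair) -(size_map h).
apply: uniq_leq_size; first by rewrite map_inj_in_uniq.
move=> _ /mapP [x /bnd /andP [fm gn] ->]; apply/allpairsP.
by exists (f x, g x); split; rewrite //= mem_int_range.
Qed.

Lemma intr_Fp_eq0 (q : nat) (z : int) : prime q ->
  (z%:~R == 0 :> 'F_q) = (q %| `|z|)%N.
Proof.
move=> q_pr; rewrite (dvdn_pcharf (pchar_Fp q_pr)).
by case: z => n /=; rewrite ?NegzE ?mulrNz ?oppr_eq0 ?abszN.
Qed.

Lemma intr_Fp_eq0_small (q : nat) (z : int) : prime q -> (`|z| < q)%N ->
  (z%:~R == 0 :> 'F_q) = (z == 0).
Proof.
move=> q_pr z_lt; rewrite intr_Fp_eq0 //; apply/idP/eqP => [q_dvd|-> //].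
by have := gtnNdvd _ z_lt; rewrite q_dvd; lia.
Qed.

(** * Short vectors of the lattice [x = m y] modulo [q] *)

(* A weighted sup norm: the second coordinates of interest are smaller than the
   first ones by a factor [N]. *)
Definition lnorm (N : nat) (v : int * int) : nat := maxn `|v.1| (N * `|v.2|).

(* Rounded quotient of [w] by [v] along the coordinate where [v] attains its norm. *)
Definition lcoord (N : nat) (v w : int * int) : int :=
  if (N * `|v.2| <= `|v.1|)%N then (w.1 %/ v.1)%Z else (w.2 %/ v.2)%Z.

Definition ldet (v w : int * int) : int := v.1 * w.2 - v.2 * w.1.

Definition lattice (q : nat) (m : 'F_q) (v : int * int) : bool :=
  v.1%:~R == m * v.2%:~R.

Definition shortest (q : nat) (m : 'F_q) (N : nat) (v : int * int) : Prop :=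
  [/\ lattice m v, v != 0 &
     forall w, lattice m w -> w != 0 -> (lnorm N v <= lnorm N w)%N].

Lemma shortest_exists (q : nat) (m : 'F_q) (N : nat) (w0 : int * int) :
  lattice m w0 -> w0 != 0 -> exists v, shortest m N v.
Proof.
move=> w0L w0_neq0.
pose P n := `[< exists w, [/\ lattice m w, w != 0 & lnorm N w = n] >].
have exP : exists n, P n by exists (lnorm N w0); apply/asboolP; exists w0.
case: (ex_minnP exP) => n /asboolP [v [vL v_neq0 <-]] v_min.
by exists v; split=> // w wL w_neq0; apply: v_min; apply/asboolP; exists w.
Qed.

Lemma lattice_mulB (q : nat) (m : 'F_q) (v w : int * int) (k : int) :
  lattice m v -> lattice m w -> lattice m (w.1 - k * v.1, w.2 - k * v.2).
Proof.
rewrite /lattice /= => /eqP vL /eqP wL.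
by rewrite !intrB !intrM vL wL; apply/eqP; ring.
Qed.

Lemma lattice_sub (q : nat) (m : 'F_q) (v w : int * int) :
  lattice m v -> lattice m w -> lattice m (w - v).
Proof.
by move=> vL wL; have := lattice_mulB 1 vL wL; rewrite !mul1r.
Qed.

Lemma lnorm_gt0 N v : (0 < N)%N -> v != 0 -> (0 < lnorm N v)%N.
Proof.
case: v => x y N_gt0; rewrite /lnorm /= leq_max muln_gt0 N_gt0 !absz_gt0.
by rewrite -negb_and; apply: contra => /andP [/eqP-> /eqP->].
Qed.

(** A zero determinant makes [u] proportional to [v]. Being smaller in the coordinate where [v]
    attains its norm, [u] is shorter than [v], which minimality allows only for [0]. *)
Lemma parallel_eq0 (q : nat) (m : 'F_q) (N : nat) (v u : int * int) :
  (0 < N)%N -> shortest m N v -> lattice m u -> ldet v u = 0 ->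
  (if (N * `|v.2| <= `|v.1|)%N then (`|u.1| < `|v.1|)%N
   else (`|u.2| < `|v.2|)%N) -> u = 0.
Proof.
move=> N_gt0 [vL v_neq0 v_min] uL /eqP; rewrite subr_eq0 => /eqP det0 u_small.
apply/eqP; apply: contraT => /(v_min _ uL); rewrite leqNgt => /negP; case.
have {det0} := congr1 absz det0; rewrite !abszM /lnorm.
move: u_small; case: ifP => h u_lt e.
  rewrite gtn_max !leq_max u_lt /=.
  suff -> : (N * `|u.2| < `|v.1|)%N by [].
  by nia.
have {}h : (`|v.1| < N * `|v.2|)%N by rewrite ltnNge h.
rewrite gtn_max !leq_max.
have -> : (N * `|u.2| < N * `|v.2|)%N by rewrite ltn_pmul2l.
suff -> : (`|u.1| < N * `|v.2|)%N by rewrite !orbT.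
by nia.
Qed.

(** The difference of the two vectors is parallel to [v]. As the quotients agree, its dominant
    coordinate is a difference of remainders, so [parallel_eq0] applies. *)
Lemma lcoord_inj (q : nat) (m : 'F_q) (N : nat) (v w w' : int * int) :
  (0 < N)%N -> shortest m N v -> lattice m w -> lattice m w' ->
  ldet v w = ldet v w' -> lcoord N v w = lcoord N v w' -> w = w'.
Proof.
move=> N_gt0 v_sh wL w'L det_eq coord_eq.
apply/eqP; rewrite -subr_eq0; apply/eqP.
apply: (parallel_eq0 N_gt0 v_sh (lattice_sub w'L wL)).
  by move: det_eq; rewrite /ldet /=; nia.
have [v1_neq0 v2_neq0] : ((N * `|v.2| <= `|v.1|)%N -> v.1 != 0) /\
    ((`|v.1| < N * `|v.2|)%N -> v.2 != 0).
  case: v_sh => _ v_neq0 _; have := lnorm_gt0 N_gt0 v_neq0.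
  by rewrite /lnorm -!absz_gt0; split; nia.
move: coord_eq; rewrite /lcoord; case: ifP => h e /=.
  have := divz_eq w.1 v.1; have := divz_eq w'.1 v.1; rewrite e.
  have := modz_ge0 w.1 (v1_neq0 h); have := modz_ge0 w'.1 (v1_neq0 h).
  have := ltz_mod w.1 (v1_neq0 h); have := ltz_mod w'.1 (v1_neq0 h).
  by move=> {e h v1_neq0 v2_neq0}; lia.
have {}h : (`|v.1| < N * `|v.2|)%N by rewrite ltnNge h.
have := divz_eq w.2 v.2; have := divz_eq w'.2 v.2; rewrite e.
have := modz_ge0 w.2 (v2_neq0 h); have := modz_ge0 w'.2 (v2_neq0 h).
have := ltz_mod w.2 (v2_neq0 h); have := ltz_mod w'.2 (v2_neq0 h).
by move=> {e h v1_neq0 v2_neq0}; lia.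
Qed.

(** Euclidean division: subtracting [lcoord N v w] times [v] leaves a parallel remainder that is too
    short to be nonzero. *)
Lemma lcoord_multiple (q : nat) (m : 'F_q) (N : nat) (v w : int * int) :
  (0 < N)%N -> shortest m N v -> lattice m w -> ldet v w = 0 ->
  exists k : int, w = (k * v.1, k * v.2).
Proof.
move=> N_gt0 v_sh wL det0; exists (lcoord N v w).
set k := lcoord N v w.
have uL := lattice_mulB k (let: And3 vL _ _ := v_sh in vL) wL.
suff /eqP : (w.1 - k * v.1, w.2 - k * v.2) = 0.
  by rewrite xpair_eqE !subr_eq0 => /andP [/eqP <- /eqP <-]; case: (w).
apply: (parallel_eq0 N_gt0 v_sh uL) => /=.
  by move: det0; rewrite /ldet /=; nia.
rewrite /k /lcoord; case: v_sh => _ v_neq0 _; have := lnorm_gt0 N_gt0 v_neq0.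
rewrite /lnorm; case: ifP => h v_gt0.
  have v1_neq0 : v.1 != 0 by rewrite -absz_gt0; nia.
  rewrite h -/(modz w.1 v.1).
    by have := modz_ge0 w.1 v1_neq0; have := ltz_mod w.1 v1_neq0; lia.
have v2_neq0 : v.2 != 0 by rewrite -absz_gt0; nia.
rewrite h -/(modz w.2 v.2).
by have := modz_ge0 w.2 v2_neq0; have := ltz_mod w.2 v2_neq0; lia.
Qed.

(** The successor pays for Euclidean division rounding some quotients away from zero. *)
Lemma lcoord_le (N Z : nat) (v w : int * int) :
  (0 < lnorm N v)%N -> (lnorm N w <= Z)%N ->
  (`|lcoord N v w| <= (Z %/ lnorm N v).+1)%N.
Proof.
move=> v_gt0 wZ.
suff : (`|lcoord N v w| * lnorm N v < Z + lnorm N v + 1)%N.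
  move=> lt_Z; rewrite -ltnS -(ltn_pmul2r v_gt0); apply: leq_trans lt_Z _.
  by rewrite {1}(divn_eq Z (lnorm N v)); have := ltn_pmod Z v_gt0; nia.
move: v_gt0 wZ; rewrite /lnorm /lcoord => v_gt0; rewrite geq_max => /andP [w1 w2].
have absz_bnd (x y : int) : y != 0 -> (`|(x %/ y)%Z| * `|y| <= `|x| + `|y|)%N.
  move=> y_neq0; rewrite -abszM.
  have := divz_eq x y; have := modz_ge0 x y_neq0; have := ltz_mod x y_neq0.
  by move: ((x %/ y)%Z * y) => p; lia.
case: ifP => h.
  have := absz_bnd w.1 v.1; rewrite -absz_gt0 (maxn_idPl h).
  by move: v_gt0; rewrite (maxn_idPl h) => -> /(_ isT); lia.
have {}h : (`|v.1| <= N * `|v.2|)%N by rewrite ltnW // ltnNge h.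
have := absz_bnd w.2 v.2; rewrite -absz_gt0 (maxn_idPr h).
by move: v_gt0; rewrite (maxn_idPr h) muln_gt0 => /andP [N_gt0 ->] /(_ isT); nia.
Qed.

Lemma dvd_ldet (q : nat) (m : 'F_q) (v w : int * int) : prime q ->
  lattice m v -> lattice m w -> (q %| `|ldet v w|)%N.
Proof.
rewrite /lattice => q_pr /eqP vL /eqP wL; rewrite -intr_Fp_eq0 //.
by rewrite /ldet intrB !intrM vL wL; apply/eqP; ring.
Qed.

Lemma ldet_le (N Z : nat) (v w : int * int) : (lnorm N w <= Z)%N ->
  (N * `|ldet v w| <= 2 * lnorm N v * Z)%N.
Proof.
rewrite /lnorm geq_max => /andP [w1 w2].
have := leq_maxl `|v.1|%N (N * `|v.2|)%N; have := leq_maxr `|v.1|%N (N * `|v.2|)%N.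
move: (maxn _ _) => M v2 v1.
have : (`|ldet v w| <= `|v.1| * `|w.2| + `|v.2| * `|w.1|)%N.
  by rewrite -!abszM /ldet; lia.
have : (`|v.1| * (N * `|w.2|) <= M * Z)%N by apply: leq_mul.
have : ((N * `|v.2|) * `|w.1| <= M * Z)%N by apply: leq_mul.
nia.
Qed.

(* [w |-> (ldet v w / q, lcoord N v w)] is injective on the lattice. Since one
   determinant is nonzero, the number of values of the first component is
   [O (|v| Z / (N q))], while the second one takes [O (Z / |v|)] values. *)
Lemma lattice_count (q : nat) (m : 'F_q) (N Z : nat) (v w0 : int * int)
    (W : seq (int * int)) :
  prime q -> (0 < N)%N -> shortest m N v -> uniq W ->
  (forall w, w \in W -> lattice m w && (lnorm N w <= Z)%N) ->
  w0 \in W -> ldet v w0 != 0 ->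
  (size W * (N * q) <= 30 * Z ^ 2)%N.
Proof.
move=> q_pr N_gt0 v_sh W_uniq W_in w0W det0.
have [vL v_neq0 v_min] := v_sh.
have v_gt0 := lnorm_gt0 N_gt0 v_neq0.
set T := ((2 * lnorm N v * Z) %/ (N * q))%N; set P := (Z %/ lnorm N v)%N.
have q_gt0 := prime_gt0 q_pr.
have Nq_gt0 : (0 < N * q)%N by rewrite muln_gt0 N_gt0.
have det_bnd w : w \in W -> (`|(ldet v w %/ q%:Z)%Z| <= T)%N.
  move=> /W_in /andP [wL wZ]; rewrite leq_divRL // mulnCA.
  have /dvdzP [t tE] : (q%:Z %| ldet v w)%Z by apply: dvd_ldet wL.
  have := ldet_le v wZ; rewrite tE mulzK; last by lia.
  by rewrite abszM; nia.
(* Positivity of [T] and [P] comes from [w0]: its determinant is a nonzero multiple of [q], and it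
   is at least as long as [v]. *)
have T_gt0 : (0 < T)%N.
  have := det_bnd _ w0W; case/andP: (W_in _ w0W) => w0L _.
  have /dvdzP [t tE] : (q%:Z %| ldet v w0)%Z by apply: dvd_ldet w0L.
  by move: det0; rewrite tE mulf_eq0 mulzK; lia.
have P_gt0 : (0 < P)%N.
  have /andP [w0L w0Z] := W_in _ w0W.
  rewrite divn_gt0 //; apply: leq_trans w0Z; apply: v_min => //.
  by apply: contra_neq det0 => ->; rewrite /ldet !mulr0 subrr.
have : (size W <= T.*2.+1 * P.+1.*2.+1)%N.
  apply: (size_le_box (f := fun w => (ldet v w %/ q%:Z)%Z) (g := lcoord N v)) => //.
    move=> w w' /W_in /andP [wL wZ] /W_in /andP [w'L w'Z] [] e1 e2.
    apply: (lcoord_inj N_gt0 v_sh wL w'L _ e2).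
    have /divzK <- : (q%:Z %| ldet v w)%Z by apply: dvd_ldet wL.
    have /divzK <- : (q%:Z %| ldet v w')%Z by apply: dvd_ldet w'L.
    by rewrite e1.
  move=> w wW; rewrite det_bnd //=; apply: lcoord_le => //.
  by case/andP: (W_in _ wW).
have : (T * (N * q) <= 2 * lnorm N v * Z)%N by apply: leq_trunc_div.
have : (P * lnorm N v <= Z)%N by apply: leq_trunc_div.
move: (lnorm N v) v_gt0 => V V_gt0 PV TV sW.
(* As [T] and [P] are positive, [2T + 1 <= 3T] and [2P + 3 <= 5P]. *)
have {}sW : (size W <= 15 * (T * P))%N by nia.
have : (T * P * (N * q) <= 2 * Z ^ 2)%N.
  apply: (@leq_trans (2 * V * Z * P)); first by rewrite mulnAC leq_mul2r TV orbT.
  have -> : (2 * V * Z * P = 2 * (Z * (P * V)))%N by ring.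
  by rewrite leq_mul2l leq_mul2l PV orbT.
move=> TPN; apply: leq_trans (_ : 15 * (T * P) * (N * q) <= _)%N.
  by rewrite leq_mul2r sW orbT.
by rewrite -mulnA; lia.
Qed.

(** With [e = |x| - |y|] the factors [e] and [e + 2|y|] are natural numbers, ready for the gcd
    argument of [card_curve_line]. *)
Lemma absz_sqr_sub (x y : int) : (`|y| <= `|x|)%N ->
  `|(x ^+ 2 - y ^+ 2)%R|%N = ((`|x| - `|y|) * (`|x| - `|y| + 2 * `|y|))%N.
Proof.
move=> le_yx; have sqrE (z : int) : z ^+ 2 = `|z|%N%:Z ^+ 2 by rewrite abszE real_normK // num_real.
rewrite (sqrE x) (sqrE y) -(subnK le_yx).
have -> : (`|x| - `|y| + `|y|)%N%:Z ^+ 2 - `|y|%N%:Z ^+ 2 =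
    ((`|x| - `|y|) * (`|x| - `|y| + 2 * `|y|))%N%:Z.
  by rewrite !(PoszD, PoszM); ring.
by rewrite addnK absz_nat.
Qed.

(** * Points of the parabola in a box *)

(* [i : 'I_N] stands for the integer [i + 1] of [1, N]. *)
Definition dif (N : nat) (p : 'I_N * 'I_N) : int := p.1%:Z - p.2%:Z.

Definition tot (N : nat) (p : 'I_N * 'I_N) : int := p.1.+1%:Z + p.2.+1%:Z.

Definition curve (q N : nat) (mu : 'F_q) : {set 'I_N * 'I_N} :=
  [set p | (dif p)%:~R ^+ 2 + mu ^+ 2 == 2%:R * mu * (tot p)%:~R].

Definition step (N : nat) (p p' : 'I_N * 'I_N) : int * int :=
  (dif p ^+ 2 - dif p' ^+ 2, tot p - tot p').

Lemma dif_lt (N : nat) (p : 'I_N * 'I_N) : (`|dif p| < N)%N.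
Proof. by rewrite /dif; have := ltn_ord p.1; have := ltn_ord p.2; lia. Qed.

Lemma tot_sub_le (N : nat) (p p' : 'I_N * 'I_N) : (`|(tot p - tot p')%R| <= 2 * N)%N.
Proof.
rewrite /tot; have := ltn_ord p.1; have := ltn_ord p.2.
by have := ltn_ord p'.1; have := ltn_ord p'.2; lia.
Qed.

Lemma dif_tot_inj (N : nat) (p p' : 'I_N * 'I_N) :
  dif p = dif p' -> tot p = tot p' -> p = p'.
Proof.
case: p p' => [a b] [c d]; rewrite /dif /tot /= => e1 e2.
by congr pair; apply: val_inj => /=; lia.
Qed.

Lemma step1_le (N : nat) (p p' : 'I_N * 'I_N) : (`|(step p p').1| <= N ^ 2)%N.
Proof. by rewrite /step /=; have := dif_lt p; have := dif_lt p'; nia. Qed.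

Lemma lnorm_step_le (N : nat) (p p' : 'I_N * 'I_N) :
  (lnorm N (step p p') <= 2 * N ^ 2)%N.
Proof.
rewrite /lnorm geq_max; have := step1_le p p'; have := tot_sub_le p p'.
by rewrite /step /=; nia.
Qed.

Section Curve.

Variables (q N : nat) (mu : 'F_q).
Hypotheses (q_pr : prime q) (N_gt0 : (0 < N)%N) (N_lt : (4 * N < q)%N).
Hypothesis mu_neq0 : mu != 0.

Let P : {set 'I_N * 'I_N} := curve N mu.

Lemma double_mu_neq0 : 2%:R * mu != 0.
Proof.
rewrite mulf_neq0 // -(dvdn_pcharf (pchar_Fp q_pr)).
by apply/negP => /dvdn_leq; lia.
Qed.

Lemma lattice_step p p' : p \in P -> p' \in P -> lattice (2%:R * mu) (step p p').
Proof.
rewrite /lattice !inE /= => /eqP e /eqP e'.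
by rewrite !intrB mulrBr -e -e' !rmorphXn /=; apply/eqP; ring.
Qed.

Lemma lattice_axis1 (v : int * int) : lattice (2%:R * mu) v ->
  (`|v.2| < q)%N -> v.1 = 0 -> v.2 = 0.
Proof.
rewrite /lattice => vL v2_lt v1; apply/eqP; rewrite -(intr_Fp_eq0_small q_pr) //.
by move: vL; rewrite v1 eq_sym mulf_eq0 (negPf double_mu_neq0).
Qed.

Lemma step_axis1 p p' : p \in P -> p' \in P ->
  (step p p').1 = 0 -> (step p p').2 = 0.
Proof.
move=> pP p'P; apply: lattice_axis1; first exact: lattice_step.
by have := tot_sub_le p p'; rewrite /step /=; lia.
Qed.

(** Here [q] divides [d^2 - d'^2 = (d - d')(d + d')], and both factors are below [2N < q] in
    absolute value. *)
Lemma step_axis2 p p' : p \in P -> p' \in P ->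
  (step p p').2 = 0 -> (step p p').1 = 0.
Proof.
move=> pP p'P e2; have := lattice_step pP p'P.
have := dif_lt p; have := dif_lt p' => d' d.
rewrite /lattice e2 mulr0 /= subr_sqr intrM mulf_eq0 !intr_Fp_eq0_small //; [|lia..].
by rewrite -mulf_eq0 => /eqP.
Qed.

(** On the parabola [d] determines [s] modulo [q], and two values of [s] differ by at most
    [2N < q]. *)
Lemma dif_inj p p' : p \in P -> p' \in P -> dif p = dif p' -> p = p'.
Proof.
move=> pP p'P e; apply: dif_tot_inj => //; apply/eqP; rewrite -subr_eq0; apply/eqP.
by apply: (step_axis1 pP p'P); rewrite /step /= e subrr.
Qed.

(** * The size of a single parabola, from a bound [T] on divisor counts *)

Section DivisorBound.

Variable T : nat.
Hypothesis T_bound : forall n : nat, (0 < n <= N ^ 2)%N -> (size (divisors n) <= T)%N.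

(** The two values of [dif] agree up to sign, so by [dif_inj] the second point is fixed by the first
    one and a sign. *)
Lemma card_flat_pairs :
  (#|[set x | [&& x.1 \in P, x.2 \in P & (step x.1 x.2).1 == 0%R]]| <= 2 * #|P|)%N.
Proof.
pose f (x : ('I_N * 'I_N) * ('I_N * 'I_N)) := (x.1, dif x.1 == dif x.2).
pose s := [seq (p, b) | p <- enum P, b <- [:: true; false]].
have -> : (2 * #|P| = size s)%N by rewrite size_allpairs -cardE mulnC.
apply: (card_le_inj_in (f := f)) => [[p p1] [p' p2]|[p p1]].
  rewrite inE /= subr_eq0 => /and3P [pP p1P e1].
  rewrite inE /= subr_eq0 => /and3P [_ p2P e2].
  case=> epp eb; rewrite -epp in e2 eb *; congr pair.
  apply: dif_inj => //; move: e1 e2; rewrite !eqf_sqr -eb.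
  case: (boolP (dif p == dif p1)) eb => [/eqP <- /esym/eqP //|_ _ /=].
  by move=> /eqP ->; rewrite eqr_opp => /eqP.
rewrite inE /= => /and3P [pP _ _].
apply/allpairsP; exists (p, dif p == dif p1); split; rewrite ?mem_enum //=.
by case: eqP.
Qed.

(** Given the step, the difference of the two values of [dif] is a signed divisor of its nonzero
    first coordinate, which leaves [2T] choices. The cofactor is their sum, so both values are known
    and [dif_inj] recovers the points. *)
Lemma card_steep_pairs (W : seq (int * int)) :
  (forall p p', p \in P -> p' \in P -> step p p' \in W) ->
  (#|[set x | [&& x.1 \in P, x.2 \in P & (step x.1 x.2).1 != 0%R]]| <= 2 * T * size W)%N.
Proof.
move=> W_step.
pose e (x : ('I_N * 'I_N) * ('I_N * 'I_N)) : int := dif x.1 - dif x.2.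
pose D (x : ('I_N * 'I_N) * ('I_N * 'I_N)) := divisors `|(step x.1 x.2).1|.
pose f x := (step x.1 x.2, (0%R <= e x, index `|e x|%N (D x))).
pose s := [seq (w, c) | w <- W, c <- [seq (b, i) | b <- [:: true; false], i <- iota 0 T]].
have -> : (2 * T * size W = size s)%N by rewrite !size_allpairs size_iota mulnC.
have e_dvd x : (step x.1 x.2).1 != 0 -> `|e x|%N \in D x.
  rewrite -absz_gt0 /D => st0; rewrite -dvdn_divisors //.
  by rewrite /step /= subr_sqr abszM dvdn_mulr.
apply: (card_le_inj_in (f := f)) => [x x'|x].
  rewrite inE => /and3P [x1 x2 nx].
  rewrite inE => /and3P [x'1 x'2 nx'].
  case=> e1 e2 e3 e4.
  have De : D x = D x' by rewrite /D /step /= e1.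
  have abs_e : `|e x|%N = `|e x'|%N.
    by rewrite -(nth_index 0%N (e_dvd _ nx)) e4 De nth_index // e_dvd.
  have ee : e x = e x' by lia.
  have dd : dif x.1 + dif x.2 = dif x'.1 + dif x'.2.
    move: nx; rewrite /= subr_sqr mulf_eq0 => /norP [nx _].
    apply: (mulfI nx); move: e1; rewrite !subr_sqr => ->.
    by move: ee; rewrite /e => ->.
  rewrite (surjective_pairing x) (surjective_pairing x').
  have [d1 d2] : dif x.1 = dif x'.1 /\ dif x.2 = dif x'.2.
    move: ee dd; rewrite /e /=; clear.
    by move: (dif x.1) (dif x.2) (dif x'.1) (dif x'.2); lia.
  by congr pair; apply: dif_inj.
rewrite inE => /and3P [x1 x2 nx].
apply/allpairsP; exists (f x); split; [exact: W_step| |by []].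
apply/allpairsP; exists (f x).2; split; [by rewrite !inE; case: (X in X == true)| |by []].
rewrite mem_iota add0n /=; have := e_dvd _ nx; rewrite -index_mem => /leq_trans.
by apply; apply: T_bound; rewrite absz_gt0 nx step1_le.
Qed.

(** [K] is the number of distinct steps, bounded by [lattice_count] with [Z = 2 N^2]; the constant
    is [30 * 2^2 = 120]. *)
Lemma card_curve_spread (v w0 : int * int) p0 p1 :
  p0 \in P -> p1 \in P -> shortest (2%:R * mu) N v -> ldet v (step p0 p1) != 0 ->
  exists2 K, (K * q <= 120 * N ^ 3)%N & (#|P| ^ 2 <= 2 * #|P| + 2 * T * K)%N.
Proof.
move=> p0P p1P v_sh det0.
pose W := undup [seq step x y | x <- enum P, y <- enum P].
have W_step p p' : p \in P -> p' \in P -> step p p' \in W.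
  by move=> pP p'P; rewrite mem_undup; apply: allpairs_f; rewrite mem_enum.
exists (size W).
  have : (size W * (N * q) <= 30 * (2 * N ^ 2) ^ 2)%N.
    apply: (lattice_count q_pr N_gt0 v_sh _ _ (W_step _ _ p0P p1P) det0).
      exact: undup_uniq.
    move=> w; rewrite mem_undup => /allpairsP [[p p'] [/= pP p'P ->]].
    by rewrite !mem_enum in pP p'P; rewrite lattice_step // lnorm_step_le.
  move=> sW; rewrite -(leq_pmul2l N_gt0) mulnCA; apply: leq_trans sW _.
  by rewrite leq_eqVlt; apply/orP; left; apply/eqP; ring.
have -> : (#|P| ^ 2 = #|setX P P|)%N by rewrite cardsX mulnn.
apply: leq_trans _ (leq_add card_flat_pairs (card_steep_pairs W_step)).
apply: leq_trans (leq_card_setU _ _); apply: subset_leq_card.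
apply/subsetP => -[x y]; rewrite in_setX => /andP [xP yP].
by apply/setUP; case: (boolP ((step x y).1 == 0)) => h; [left|right];
  rewrite in_set /= xP yP h.
Qed.

(* For [d >= d0 >= 0] with [a] dividing [d^2 - d0^2], put [u = gcd a (d - d0)].
   Then [d] is fixed modulo [u] and modulo [a / u], hence modulo their lcm,
   which is [a / g] with [g = gcd u (a / u)] and [g^2] dividing [a]. *)
Lemma card_curve_line (a b : int) p1 : p1 \in P ->
  a != 0 -> b != 0 -> (`|a| <= N ^ 2)%N ->
  (forall p p', p \in P -> p' \in P -> exists k : int, step p p' = (k * a, k * b)) ->
  exists g m : nat,
    [/\ (g ^ 2 %| `|a|)%N, (m ^ 2 * (`|a| * `|b|) <= 2 * N * g ^ 2)%N &
        (#|P| <= 2 * T * m.+1)%N].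
Proof.
move=> p1P a_neq0 b_neq0 a_le mult.
have a_gt0 : (0 < `|a|)%N by rewrite absz_gt0.
(* Measuring from a point with least [|dif|] keeps the natural subtraction in [e] from being
   truncated. *)
case: (arg_minnP (fun p : 'I_N * 'I_N => `|dif p|%N) p1P) => p0 p0P p0_min.
pose e (p : 'I_N * 'I_N) := (`|dif p| - `|dif p0|)%N.
pose u p := gcdn `|a| (e p).
pose G p := gcdn (u p) (`|a| %/ u p).
pose l p := lcmn (u p) (`|a| %/ u p).
have u_dvd p : (u p %| `|a|)%N by apply: dvdn_gcdl.
have u_gt0 p : (0 < u p)%N by rewrite gcdn_gt0 a_gt0.
have lG p : (l p * G p = `|a|)%N.
  by rewrite muln_lcm_gcd mulnC divnK.
have l_gt0 p : (0 < l p)%N by move: a_gt0; rewrite -(lG p) muln_gt0 => /andP [].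
have e_mult p : p \in P -> exists k : nat,
    (e p * (e p + 2 * `|dif p0|) = k * `|a|)%N /\ (k * `|b| <= 2 * N)%N.
  move=> pP; have [k [k1 k2]] := mult p p0 pP p0P; exists `|k|%N.
  rewrite -!abszM -k1 -k2 tot_sub_le; split=> //.
  by rewrite absz_sqr_sub // p0_min.
(* [e^2 <= e (e + 2|d0|) = k |a|], while [k |b|] is a difference of totals, at most [2N]. *)
have e_sq p : p \in P -> (e p ^ 2 * `|b| <= 2 * N * `|a|)%N.
  move=> /e_mult [k [k1 k2]]; apply: (@leq_trans (k * `|a| * `|b|)).
    by rewrite leq_mul2r -k1 -mulnn leq_mul2l leq_addr !orbT.
  by rewrite mulnAC leq_mul2r k2 orbT.
have u_dvd2 p : p \in P -> (`|a| %/ u p %| e p + 2 * `|dif p0|)%N.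
  move=> /e_mult [k [k1 _]].
  have cop : coprime (`|a| %/ u p) (e p %/ u p).
    by rewrite /coprime -(eqn_pmul2r (u_gt0 p)) muln_gcdl !divnK ?dvdn_gcdr // mul1n.
  rewrite -(Gauss_dvdr _ cop) -(dvdn_pmul2l (u_gt0 p)) mulnA !(mulnC (u p)).
  by rewrite !divnK ?dvdn_gcdr // k1 dvdn_mull.
have e_eq p p' : p \in P -> p' \in P -> u p = u p' ->
    (e p %/ l p = e p' %/ l p')%N -> e p = e p'.
  wlog le_e : p p' / (e p <= e p')%N => [hw pP p'P uu qq|].
    by case/orP: (leq_total (e p) (e p')) => le; [|symmetry]; apply: hw.
  move=> pP p'P uu; have ll : l p = l p' by rewrite /l uu.
  have l_dvd : (l p %| e p' - e p)%N.
    rewrite dvdn_lcm; apply/andP; split.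
      by apply: dvdn_sub; [rewrite uu|]; apply: dvdn_gcdr.
    have -> : (e p' - e p = (e p' + 2 * `|dif p0|) - (e p + 2 * `|dif p0|))%N by lia.
    by apply: dvdn_sub; [rewrite uu|]; apply: u_dvd2.
  rewrite -ll => qq; have := divn_eq (e p) (l p); have := divn_eq (e p') (l p).
  move: l_dvd; rewrite -eqn_mod_dvd // => /eqP ->.
  by rewrite qq => {2}-> <-.
pose m := \max_(p in P) (e p %/ l p)%N.
have [pm pmP mE] : exists2 p, p \in P & m = (e p %/ l p)%N.
  have P_gt0 : (0 < #|P|)%N by apply/card_gt0P; exists p1.
  by have [p pP pE] := eq_bigmax_cond (fun p => e p %/ l p)%N P_gt0; exists p.
(* The point [pm] has the largest quotient [m]. Since [m l <= e] and [l G = |a|], the bound [e_sq]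
   becomes the one on [m]. *)
exists (G pm), m; split.
- rewrite -(divnK (u_dvd pm)) -mulnn.
  by apply: dvdn_mul; [apply: dvdn_gcdr | apply: dvdn_gcdl].
- rewrite -(leq_pmul2r a_gt0).
  apply: (@leq_trans (e pm ^ 2 * `|b| * G pm ^ 2)).
    have -> : (m ^ 2 * (`|a| * `|b|) * `|a| = (m * l pm) ^ 2 * `|b| * G pm ^ 2)%N.
      by rewrite -(lG pm); ring.
    by rewrite !leq_mul2r leq_exp2r // mE leq_trunc_div !orbT.
  by rewrite [leqRHS]mulnAC leq_mul2r e_sq ?orbT.
(* A point is recovered from [u], the sign of [dif] and the quotient of [e] by [l]: at most [T], [2]
   and [m + 1] choices. *)
- pose f (p : 'I_N * 'I_N) := (u p, (0 <= dif p, (e p %/ l p)%N)).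
  pose s := [seq (w, c) | w <- divisors `|a|,
               c <- [seq (b, i) | b <- [:: true; false], i <- iota 0 m.+1]].
  have sT : (size s <= 2 * T * m.+1)%N.
    rewrite !size_allpairs size_iota /= mulnCA mulnA leq_mul2r.
    by rewrite leq_mul2l T_bound ?a_gt0 ?orbT.
  apply: leq_trans sT; apply: (card_le_inj_in (f := f)) => [p p' pP p'P|p pP].
    case=> e1 e2 e3; apply: dif_inj => //.
    have abs_eq : `|dif p|%N = `|dif p'|%N.
      by rewrite -(subnK (p0_min _ pP)) -(subnK (p0_min _ p'P)) -!/(e _) (e_eq p p').
    by move: e2 abs_eq; clear; move: (dif p) (dif p') => x y; lia.
  apply/allpairsP; exists (f p); split; [by rewrite /= -dvdn_divisors // u_dvd| |by []].
  apply/allpairsP; exists (f p).2; split; [| |by []].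
    by rewrite !inE; case: (X in X == true).
  rewrite mem_iota /= add0n ltnS.
  exact: (leq_bigmax_cond (F := fun p => (e p %/ l p)%N)).
Qed.

(** If every step has first coordinate zero, [K = 0] works. Otherwise take a shortest lattice
    vector: either some step is not parallel to it, or it is some [(a, b)] dividing all steps and
    inherits its size bounds from a step that is a nonzero multiple. *)
Lemma card_curve_cases :
  (exists2 K, (K * q <= 120 * N ^ 3)%N & (#|P| ^ 2 <= 2 * #|P| + 2 * T * K)%N) \/
  (exists a b : int, exists g m : nat,
    [/\ a != 0, b != 0, (`|a| <= N ^ 2)%N, (`|b| <= 2 * N)%N &
        a%:~R = 2%:R * mu * b%:~R] /\
    [/\ (g ^ 2 %| `|a|)%N, (m ^ 2 * (`|a| * `|b|) <= 2 * N * g ^ 2)%N &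
        (#|P| <= 2 * T * m.+1)%N]).
Proof.
have [/existsP [[p0 p1] /= /and3P [p0P p1P st0]]|] :=
  boolP [exists x, [&& x.1 \in P, x.2 \in P & (step x.1 x.2).1 != 0%R]]; last first.
  move=> /existsPn no_steep; left; exists 0%N; rewrite ?mul0n // muln0 addn0.
  have -> : (#|P| ^ 2 = #|setX P P|)%N by rewrite cardsX mulnn.
  apply: leq_trans _ card_flat_pairs; apply: subset_leq_card.
  apply/subsetP => -[x y]; rewrite in_setX => /andP [xP yP].
  by have := no_steep (x, y); rewrite in_set /= xP yP /= negbK.
have {}st0 : (step p0 p1).1 != 0 := st0.
have st_neq0 : step p0 p1 != 0 by apply: contra_neq st0 => ->.
have [v v_sh] := shortest_exists N (lattice_step p0P p1P) st_neq0.
have [/existsP [[p p'] /= /and3P [pP p'P det0]]|] :=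
  boolP [exists x, [&& x.1 \in P, x.2 \in P & ldet v (step x.1 x.2) != 0]].
  by left; apply: card_curve_spread pP p'P v_sh det0.
move=> /existsPn flat; right; case: v v_sh flat => [a b] ab_sh flat.
have mult x y : x \in P -> y \in P -> exists k : int, step x y = (k * a, k * b).
  move=> xP yP; apply: (lcoord_multiple N_gt0 ab_sh (lattice_step xP yP)).
  by have := flat (x, y); rewrite /= xP yP /= negbK => /eqP.
have [k kE] := mult p0 p1 p0P p1P.
have ka : k * a != 0 by move: st0; rewrite kE.
have kb : k * b != 0.
  by apply: contra_neq st0 => kb0; apply: step_axis2; rewrite // kE.
have /norP [k0 a0] : ~~ ((k == 0) || (a == 0)) by rewrite -mulf_eq0.
have b0 : b != 0 by apply: contra_neq kb => ->; rewrite mulr0.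
have k_gt0 : (0 < `|k|)%N by rewrite absz_gt0.
have a_le : (`|a| <= N ^ 2)%N.
  by apply: leq_trans (step1_le p0 p1); rewrite kE abszM leq_pmull.
have b_le : (`|b| <= 2 * N)%N.
  apply: leq_trans (tot_sub_le p0 p1).
  by have := congr1 snd kE; rewrite /step /= => ->; rewrite abszM leq_pmull.
have [g [m gm]] := card_curve_line p0P a0 b0 a_le mult.
exists a, b, g, m; split=> //; split=> //.
by case: ab_sh => /eqP.
Qed.

End DivisorBound.

End Curve.

Lemma card_sqrt_le2 (F : finFieldType) (c : F) :
  (#|[set b : F | b ^+ 2 == c]| <= 2)%N.
Proof.
have [->|[b0]] := set_0Vmem [set b : F | b ^+ 2 == c]; first by rewrite cards0.
rewrite inE => /eqP b0c; apply: leq_trans (subset_leq_card _) _; last first.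
  exact: (card_size [:: b0; - b0]).
by apply/subsetP => b; rewrite !inE -b0c eqf_sqr.
Qed.

(** * Reduction of the energy to parabolas *)

Section Energy.

Variables (q N : nat) (j : 'F_q).
Hypotheses (q_pr : prime q) (j_neq0 : j != 0).

Let S : {set 'F_q} := [set b | b ^+ 2 \in multiples N j].

Lemma card_sqrt_multiples : (#|S| <= 2 * N)%N.
Proof.
have -> : S = \bigcup_(n : 'I_N) [set b | b ^+ 2 == n.+1%:R * j].
  apply/setP => b; rewrite inE; apply/imsetP/bigcupP => [[n _ e]|[n _]].
    by exists n; rewrite // inE e.
  by rewrite inE => /eqP e; exists n.
have -> : (2 * N = \sum_(n < N) 2)%N by rewrite sum_nat_const card_ord mulnC.
apply: (big_ind2 (fun (A : {set 'F_q}) m => #|A| <= m)%N) => [|A m B n Am Bn|n _].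
- by rewrite cards0.
- by apply: leq_trans (leq_card_setU _ _) _; apply: leq_add.
- exact: card_sqrt_le2.
Qed.

(** Three of the variables determine the fourth. This trivial bound serves the range [q <= 4 N]. *)
Lemma T22_le_cube : (T22 N j <= (2 * N) ^ 3)%N.
Proof.
have : (#|S| ^ 3 <= (2 * N) ^ 3)%N by rewrite leq_exp2r // card_sqrt_multiples.
apply: leq_trans.
have -> : (#|S| ^ 3 = size [seq (x, y) | x <- [seq (x, y) | x <- enum S, y <- enum S], y <- enum S])%N.
  by rewrite !size_allpairs -cardE; ring.
apply: (card_le_inj_in (f := fst)).
  move=> [[[b1 b2] b3] b4] [[[c1 c2] c3] c4]; rewrite !inE.
  move=> /and5P [/eqP e _ _ _ _] /and5P [/eqP e' _ _ _ _] [] e1 e2 e3.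
  by move: e e'; rewrite e1 e2 e3 => -> /addrI ->.
move=> [[[b1 b2] b3] b4]; rewrite inE => /and5P [_ b1S b2S b3S _].
by rewrite !allpairs_f // mem_enum inE.
Qed.

Definition sum_pairs (lam : 'F_q) : {set 'F_q * 'F_q} :=
  [set b | [&& b.1 + b.2 == lam, b.1 \in S & b.2 \in S]].

Lemma T22_le_sum : (T22 N j <= \sum_lam #|sum_pairs lam| ^ 2)%N.
Proof.
rewrite /T22 -sum1_card (partition_big (fun b => b.1.1.1 + b.1.1.2) predT) //=.
apply: leq_sum => lam _; rewrite -mulnn -cardsX sum1dep_card [leqRHS]cardE.
apply: (card_le_inj_in (f := fun b => (b.1.1, (b.1.2, b.2)))).
  by move=> [[[b1 b2] b3] b4] [[[c1 c2] c3] c4] _ _ /= [] -> -> -> ->.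
move=> [[[b1 b2] b3] b4]; rewrite in_set => /andP [].
rewrite in_set => /and5P [/eqP e b1S b2S b3S b4S] /eqP /= b12.
by rewrite mem_enum in_setX !inE /= b1S b2S b3S b4S -e b12 eqxx.
Qed.

Hypotheses (N_gt0 : (0 < N)%N) (N_lt : (4 * N < q)%N).

(** The sum [0] would give [mu = 0], where the parabola degenerates, so it is counted directly from
    [b2 = - b1]. *)
Lemma card_sum_pairs0 : (#|sum_pairs 0%R| <= 2 * N)%N.
Proof.
apply: leq_trans card_sqrt_multiples; rewrite [leqRHS]cardE.
apply: (card_le_inj_in (f := fst)) => [[b1 b2] [c1 c2]|[b1 b2]].
  rewrite !in_set /= => /and3P [/eqP e _ _] /and3P [/eqP e' _ _] e1.
  by rewrite e1 in e *; congr pair; apply: (addrI c1); rewrite e e'.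
by rewrite in_set mem_enum => /and3P [].
Qed.

Let two_neq0 : 2%:R != 0 :> 'F_q.
Proof. by rewrite -(dvdn_pcharf (pchar_Fp q_pr)); apply/negP => /dvdn_leq; lia. Qed.

(** The integers [n_i] give the [b_i^2], hence [b1 - b2 = (b1^2 - b2^2) / lam]; together with [lam]
    this gives both [b_i], as [2] is invertible. *)
Lemma card_sum_pairs (lam : 'F_q) : lam != 0 ->
  (#|sum_pairs lam| <= #|curve N (lam ^+ 2 / j)|)%N.
Proof.
move=> lam_neq0.
(* The default [Ordinal N_gt0] is never reached for [b] in [S]. *)
pose n (b : 'F_q) : 'I_N := odflt (Ordinal N_gt0) [pick i : 'I_N | b ^+ 2 == i.+1%:R * j].
have nE b : b \in S -> b ^+ 2 = (n b).+1%:R * j.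
  rewrite inE => /imsetP [i _ e]; rewrite /n; case: pickP => [k /eqP //|/(_ i)].
  by rewrite e eqxx.
rewrite (cardE (curve _ _)).
apply: (card_le_inj_in (f := fun b => (n b.1, n b.2))) => [[b1 b2] [c1 c2]|[b1 b2]].
  rewrite in_set /= => /and3P [/eqP b_sum b1S b2S].
  rewrite in_set /= => /and3P [/eqP c_sum c1S c2S] [] e1 e2.
  have sq1 : b1 ^+ 2 = c1 ^+ 2 by rewrite !nE // e1.
  have sq2 : b2 ^+ 2 = c2 ^+ 2 by rewrite !nE // e2.
  have b_dif : b1 - b2 = c1 - c2.
    by apply: (mulIf lam_neq0); rewrite -{1}b_sum -c_sum -!subr_sqr sq1 sq2.
  have b1c1 : b1 = c1.
    apply: (mulfI two_neq0).
    have -> : 2%:R * b1 = (b1 + b2) + (b1 - b2) by ring.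
    have -> : 2%:R * c1 = (c1 + c2) + (c1 - c2) by ring.
    by rewrite b_sum c_sum b_dif.
  by rewrite b1c1 in b_sum *; congr pair; apply: (addrI c1); rewrite b_sum c_sum.
rewrite in_set mem_enum /= => /and3P [/eqP b_sum b1S b2S].
rewrite in_set.
have dif_j : (dif (n b1, n b2))%:~R * j = lam * (b1 - b2).
  have -> : dif (n b1, n b2) = (n b1).+1%:Z - (n b2).+1%:Z by rewrite /dif /=; lia.
  by rewrite intrB mulrBl -!nE // -b_sum; ring.
have tot_j : (tot (n b1, n b2))%:~R * j = b1 ^+ 2 + b2 ^+ 2.
  by rewrite /tot intrD mulrDl /= -!nE.
have mu_j : lam ^+ 2 / j * j = lam ^+ 2 by rewrite divfK.
have j2 : j ^+ 2 != 0 by rewrite expf_neq0.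
move: (_ / _) mu_j (dif _)%:~R dif_j (tot _)%:~R tot_j => mu mu_j D D_j t t_j.
(* Multiplied by [j^2], the equation is [lam^2 ((b1 - b2)^2 + lam^2) = 2 lam^2 (b1^2 + b2^2)], the
   parallelogram identity for [lam = b1 + b2]. *)
rewrite -(inj_eq (mulIf j2)) mulrDl -!exprMn mu_j D_j.
have -> : 2%:R * mu * t * j ^+ 2 = 2%:R * (mu * j) * (t * j) by ring.
by rewrite mu_j t_j -b_sum; apply/eqP; ring.
Qed.

(** [lam = 0] contributes at most [(2N)^2], and [lam |-> lam^2 / j] is at most two-to-one. *)
Lemma T22_le_curve :
  (T22 N j <= 4 * N ^ 2 + 2 * \sum_(mu : 'F_q | mu != 0%R) #|curve N mu| ^ 2)%N.
Proof.
apply: leq_trans T22_le_sum _; rewrite (bigD1 (0 : 'F_q)) //=; apply: leq_add.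
  by rewrite -[4%N]/(2 ^ 2)%N -expnMn leq_exp2r // card_sum_pairs0.
pose h (lam : 'F_q) := lam ^+ 2 / j.
apply: leq_trans (_ : (\sum_(lam | lam != 0%R) #|curve N (h lam)| ^ 2 <= _)%N).
  by apply: leq_sum => lam lam_neq0; rewrite leq_exp2r // card_sum_pairs.
rewrite (partition_big h (fun mu => mu != 0)) /=; last first.
  by move=> lam lam0; rewrite /h mulf_neq0 ?expf_neq0 ?invr_neq0.
rewrite big_distrr /=; apply: leq_sum => mu _.
rewrite (eq_bigr (fun=> #|curve N mu| ^ 2)%N); last by move=> lam /andP [_ /eqP ->].
rewrite sum_nat_const leq_mul2r; apply/orP; right.
apply: leq_trans (card_sqrt_le2 (mu * j)); apply: subset_leq_card.
apply/subsetP => lam; rewrite unfold_in in_set => /andP [_ /eqP <-].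
by rewrite /h divfK.
Qed.

(** The equation is quadratic in [mu], so each of the [N^2] points lies on at most two parabolas. *)
Lemma sum_card_curve : (\sum_(mu : 'F_q) #|curve N mu| <= 2 * N ^ 2)%N.
Proof.
under eq_bigr do rewrite -sum1_card.
rewrite (exchange_big_dep predT) //=.
apply: leq_trans (_ : \sum_(p : 'I_N * 'I_N) 2 <= _)%N; last first.
  by rewrite sum_nat_const card_prod card_ord mulnC.
apply: leq_sum => p _; rewrite sum1dep_card.
have [->|[mu0]] := set_0Vmem [set mu : 'F_q | p \in curve N mu]; first by rewrite cards0.
rewrite in_set in_set => /eqP e0; apply: leq_trans (subset_leq_card _) _; last first.
  (* By Vieta the two roots add up to [2 tot p]. *)
  exact: (card_size [:: mu0; 2%:R * (tot p)%:~R - mu0]).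
apply/subsetP => mu; rewrite in_set in_set => /eqP e; rewrite !inE.
rewrite -subr_eq0 -[X in _ || X]subr_eq0 -mulf_eq0; apply/eqP.
set D := (dif p)%:~R in e e0; set t := (tot p)%:~R in e e0 *.
have -> : (mu - mu0) * (mu - (2%:R * t - mu0)) =
    (D ^+ 2 + mu ^+ 2 - 2%:R * mu * t) - (D ^+ 2 + mu0 ^+ 2 - 2%:R * mu0 * t) by ring.
by rewrite e e0 !subrr.
Qed.

End Energy.

(** * The divisor bound and harmonic sums *)

Lemma size_divisors_le_part (p n : nat) : prime p -> (0 < n)%N ->
  (size (divisors n) <= (logn p n).+1 * size (divisors n`_p^'))%N.
Proof.
move=> p_pr n_gt0; rewrite -(size_iota 0 (logn p n).+1).
rewrite -(size_allpairs (fun i d => p ^ i * d)%N).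
apply: uniq_leq_size (divisors_uniq n) _ => d; rewrite -dvdn_divisors // => d_dvd.
have d_gt0 := dvdn_gt0 n_gt0 d_dvd.
rewrite -(partnC p d_gt0) p_part; apply: allpairs_f.
  by rewrite mem_iota /= add0n ltnS dvdn_leq_log.
by rewrite -dvdn_divisors ?part_gt0 // partn_dvd.
Qed.

Section RealEstimates.

Variable R : realType.
Implicit Types (e : R) (n N q : nat).

Lemma powR_nat_ge1 e n : 0 <= e -> (0 < n)%N -> 1 <= n%:R `^ e :> R.
Proof.
by move=> e_ge0 n_gt0; rewrite -[leLHS](powRr0 n%:R) ler_powR ?ler1n.
Qed.

Lemma powR_natX e (p k : nat) : (p ^ k)%:R `^ e = (p%:R `^ e) ^+ k :> R.
Proof.
by rewrite natrX -powR_mulrn ?ler0n // -powRrM mulrC powRrM powR_mulrn ?powR_ge0.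
Qed.

(* A prime power [p^k] contributes a factor [k + 1 <= p^(k e)] unless
   [p <= 2^(1/e)], and a factor at most [K p^(k e)] in any case. *)
Lemma size_divisors_le e : 0 < e ->
  exists2 C : R, 0 < C &
    forall n, (0 < n)%N -> (size (divisors n))%:R <= C * n%:R `^ e.
Proof.
move=> e_gt0; pose c := e * ln 2%:R.
have c_gt0 : 0 < c by rewrite mulr_gt0 // ln_gt0 // ltr1n.
(* Chosen so that [K (1 + c k) >= 1 + k]. *)
pose K := 1 + c^-1; have K_ge1 : 1 <= K by rewrite lerDl invr_ge0 ltW.
have K_gt0 : 0 < K by apply: lt_le_trans K_ge1.
have small_prime (p k : nat) : (1 < p)%N -> k.+1%:R <= K * (p%:R `^ e) ^+ k.
  move=> p_gt1; apply: (@le_trans _ _ (K * (2%:R `^ e) ^+ k)); last first.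
    rewrite ler_pM2l // lerXn2r ?nnegrE ?powR_ge0 //.
    by rewrite ge0_ler_powR ?nnegrE ?ler0n ?ler_nat // ltW.
  have -> : (2%:R `^ e) ^+ k = expR (c * k%:R).
    by rewrite /powR pnatr_eq0 /= -expRM_natr mulrAC.
  apply: (@le_trans _ _ (K * (1 + c * k%:R))).
    have cK : K * (c * k%:R) = c * k%:R + k%:R.
      by rewrite /K mulrDl mul1r mulrA mulVf ?mul1r // gt_eqF.
    rewrite mulrDr mulr1 cK -natr1.
    have : 0 <= c * k%:R by rewrite mulr_ge0 ?ler0n // ltW.
    by lra.
  by rewrite ler_pM2l // expR_ge1Dx.
have [P P_ge] : exists P : nat, 2%:R `^ e^-1 <= P%:R :> R.
  exists (Num.truncn (2%:R `^ e^-1 : R)).+1; apply/ltW.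
  by rewrite truncnS_gt.
have large_prime (p k : nat) : (P < p)%N -> k.+1%:R <= (p%:R `^ e) ^+ k.
  move=> P_lt; apply: (@le_trans _ _ (2%:R ^+ k)).
    by rewrite -natrX ler_nat ltn_expl.
  rewrite lerXn2r ?nnegrE ?powR_ge0 ?ler0n //.
  have -> : 2%:R = (2%:R `^ e^-1) `^ e :> R.
    by rewrite -powRrM mulVf ?gt_eqF // powRr1 ?ler0n.
  rewrite ge0_ler_powR ?nnegrE ?powR_ge0 ?ler0n ?ltW //.
  by apply: le_lt_trans P_ge _; rewrite ltr_nat.
(* Induction on a bound [m] for the prime factors. Only primes up to [P] cost a factor [K], whence
   the exponent [minn m P]. *)
have main m : forall n, (0 < n)%N -> (forall p, prime p -> (p %| n)%N -> (p <= m)%N) ->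
    (size (divisors n))%:R <= K ^+ minn m P * n%:R `^ e.
  elim: m => [|m IH] n n_gt0 n_smooth.
    have -> : n = 1%N.
      apply/eqP; rewrite eqn_leq n_gt0 andbT leqNgt; apply/negP => /pdiv_prime h.
      by have := n_smooth _ h (pdiv_dvd n); rewrite leqn0 => /eqP h0; rewrite h0 in h.
    by rewrite min0n expr0 mul1r powR1.
  have K_mono : K ^+ minn m P <= K ^+ minn m.+1 P by rewrite ler_weXn2l //; lia.
  have [p_pr|p_npr] := boolP (prime m.+1); last first.
    apply: le_trans (IH n n_gt0 _) _; last by rewrite ler_wpM2r ?powR_ge0.
    move=> p p_pr p_dvd; have := n_smooth p p_pr p_dvd.
    by rewrite leq_eqVlt => /orP [/eqP e1|//]; rewrite e1 (negPf p_npr) in p_pr.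
  set p := m.+1 in p_pr *; set k := logn p n.
  have := size_divisors_le_part p_pr n_gt0; rewrite -(ler_nat R) natrM => /le_trans; apply.
  have n'_le : (size (divisors (n`_p^')%N))%:R <= K ^+ minn m P * (n`_p^')%N%:R `^ e.
    apply: IH; first exact: part_gt0.
    move=> r r_pr r_dvd; have := n_smooth r r_pr (dvdn_trans r_dvd (dvdn_part _ _)).
    rewrite leq_eqVlt => /orP [/eqP e1|//].
    have /(pnatP _ (part_gt0 p^' n)) /(_ r r_pr r_dvd) := part_pnat p^' n.
    by rewrite e1 !inE eqxx.
  have nE : n%:R `^ e = (p%:R `^ e) ^+ k * (n`_p^')%N%:R `^ e :> R.
    by rewrite -{1}(partnC p n_gt0) p_part natrM powRM ?ler0n // powR_natX.
  apply: (@le_trans _ _ (k.+1%:R * (K ^+ minn m P * (n`_p^')%N%:R `^ e))).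
    by rewrite ler_wpM2l ?ler0n.
  rewrite nE mulrCA !mulrA ler_wpM2r ?powR_ge0 //.
  have [p_le|P_lt] := leqP p P.
    have -> : minn m P = m by rewrite /p in p_le; lia.
    rewrite /p exprSr -mulrA ler_wpM2l ?exprn_ge0 ?(ltW K_gt0) //.
    by apply: small_prime; apply: prime_gt1.
  have -> : minn m P = P by rewrite /p in P_lt; lia.
  by rewrite ler_wpM2l ?exprn_ge0 ?(ltW K_gt0) // large_prime.
exists (K ^+ P); first by rewrite exprn_gt0.
move=> n n_gt0; apply: le_trans (main n n n_gt0 _) _.
  by move=> p _; apply: dvdn_leq.
by rewrite ler_wpM2r ?powR_ge0 // ler_weXn2l // geq_minr.
Qed.

Definition harmonic_sum n : R := \sum_(i < n) i.+1%:R^-1.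

Lemma harmonic_sum_ge0 n : 0 <= harmonic_sum n.
Proof. by apply: sumr_ge0 => i _; rewrite invr_ge0. Qed.

(** Inductive step: [1/(n+2) <= ln ((n+2)/(n+1))], which is [ln (1 + x) <= x] at [x = -1/(n+2)]. *)
Lemma harmonic_sum_le_ln n : harmonic_sum n.+1 <= 1 + ln n.+1%:R.
Proof.
elim: n => [|n IH]; first by rewrite /harmonic_sum big_ord1 ln1 addr0 invr1.
rewrite /harmonic_sum big_ord_recr /= -/(harmonic_sum _).
apply: (@le_trans _ _ (1 + ln n.+1%:R + n.+2%:R^-1)); first by rewrite lerD2r.
rewrite -addrA lerD2l.
have n1 : (0 : R) < n.+1%:R by rewrite ltr0n.
have n2 : (0 : R) < n.+2%:R by rewrite ltr0n.
have : ln (1 + - n.+2%:R^-1) <= - n.+2%:R^-1 :> R.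
  by apply: le_ln1Dx; rewrite ltrN2 invf_lt1 // ltr1n.
have -> : 1 + - n.+2%:R^-1 = n.+1%:R / n.+2%:R :> R.
  by apply: (mulIf (lt0r_neq0 n2)); rewrite mulrBl mul1r divfK ?mulVf ?gt_eqF // -natr1 addrK.
by rewrite ln_div ?posrE // => le_ln; rewrite -lerBrDr addrC -lerBlDr.
Qed.

(** [ln n <= n^e / e] follows from [ln y < y] at [y = n^e]. *)
Lemma harmonic_sum_le e n : 0 < e -> (0 < n)%N ->
  harmonic_sum n <= (1 + e^-1) * n%:R `^ e.
Proof.
case: n => // n e_gt0 _; apply: le_trans (harmonic_sum_le_ln n) _.
rewrite mulrDl mul1r lerD ?powR_nat_ge1 ?ltW //.
rewrite mulrC ltr_pdivlMr // mulrC -ln_powR ln_sublinear // powR_gt0 // ltr0n.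
Qed.

End RealEstimates.

(** * Summation over the parabolas *)

Section CurveSum.

Variables (R : realType) (q N T : nat).
Hypotheses (q_pr : prime q) (N_gt0 : (0 < N)%N) (N_lt : (4 * N < q)%N).
Hypothesis T_bound : forall n : nat, (0 < n <= N ^ 2)%N -> (size (divisors n) <= T)%N.

(** Ordinals are shifted by one: [a.+1], [b.+1], [g.+1] stand for [|a|], [|b|], [g], and the boolean
    for the sign of [a / b]. *)
Let I : finType := ('I_(N ^ 2) * 'I_(2 * N) * 'I_N * bool)%type.

Definition line_dvd (x : I) : bool :=
  let: (a, b, g, s) := x in (g.+1 ^ 2 %| a.+1)%N.

(** The upper bound for [m^2] provided by [card_curve_line]. *)
Definition line_weight (x : I) : R :=
  let: (a, b, g, s) := x in (2 * N)%:R * g.+1%:R ^+ 2 / (a.+1%:R * b.+1%:R).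

Definition line_slope (mu : 'F_q) (x : I) : bool :=
  let: (a, b, g, s) := x in (-1) ^+ s * a.+1%:R == 2%:R * mu * b.+1%:R.

(* Summing over every [(a, b, g, s)] compatible with [mu] avoids choosing the
   direction of the line that carries the differences of [curve N mu]. *)
Definition line_mass (mu : 'F_q) : R :=
  \sum_(x | line_dvd x && line_slope mu x) line_weight x.

Lemma line_weight_ge0 x : 0 <= line_weight x.
Proof.
by case: x => [[[a b] g] s]; rewrite /= divr_ge0 ?mulr_ge0 ?exprn_ge0 ?ler0n.
Qed.

Lemma line_mass_ge0 mu : 0 <= line_mass mu.
Proof. by apply: sumr_ge0 => x _; apply: line_weight_ge0. Qed.

Lemma card_line_slope x : (#|[set mu | line_slope mu x]| <= 1)%N.
Proof.
case: x => [[[a b] g] s]; apply: (card_le_inj_in (s := [:: tt]) (f := fun=> tt)) => //.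
move=> mu mu'; rewrite in_set in_set /= => /eqP -> /eqP.
have two_neq0 : 2%:R != 0 :> 'F_q.
  by rewrite -(dvdn_pcharf (pchar_Fp q_pr)); apply/negP => /dvdn_leq; lia.
have b_neq0 : b.+1%:R != 0 :> 'F_q.
  rewrite -(dvdn_pcharf (pchar_Fp q_pr)); apply/negP => /dvdn_leq => /(_ isT).
  by have := ltn_ord b; lia.
by move/(mulIf b_neq0)/(mulfI two_neq0).
Qed.

(** Writing [a.+1 = c g^2] turns the summand into [1 / c] with [c <= N^2]. *)
Lemma sum_square_multiples (g : nat) : (0 < g)%N ->
  \sum_(a < N ^ 2 | (g ^ 2 %| a.+1)%N) g%:R ^+ 2 / a.+1%:R <= harmonic_sum R (N ^ 2).
Proof.
move=> g_gt0; have g2_gt0 : (0 < g ^ 2)%N by rewrite expn_gt0 g_gt0.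
have g_neq0 : g%:R ^+ 2 != 0 :> R by rewrite -natrX pnatr_eq0 -lt0n.
rewrite /harmonic_sum big_mkcond /=.
have aE (a : 'I_(N ^ 2)) :
    (if (g ^ 2 %| a.+1)%N then g%:R ^+ 2 / a.+1%:R else 0) <=
    \sum_(c < N ^ 2 | a.+1 == (c.+1 * g ^ 2)%N) c.+1%:R^-1 :> R.
  case: ifP => [/dvdnP [[|c] ac]|_]; [by []| |by apply: sumr_ge0 => c _; rewrite invr_ge0].
  have c_lt : (c < N ^ 2)%N.
    by apply: leq_trans (ltn_ord a); rewrite ac leq_pmulr.
  rewrite (bigD1 (Ordinal c_lt)) /=; last by rewrite ac.
  rewrite ac natrM natrX invfM mulrCA divff // mulr1 lerDl.
  by apply: sumr_ge0 => d _; rewrite invr_ge0.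
apply: le_trans (ler_sum _ (fun a _ => aE a)) _.
rewrite (exchange_big_dep predT) //=; apply: ler_sum => c _.
rewrite sumr_const -[leRHS]mulr1n ler_wpMn2l ?invr_ge0 //.
rewrite -cardsE; apply: (card_le_inj_in (s := [:: tt]) (f := fun=> tt)) => //.
by move=> a a'; rewrite !in_set => /eqP e /eqP e' _; apply: val_inj; move: e e' => /= <- [].
Qed.

(** Each index is compatible with at most one [mu]. The sign then gives a factor [2], [g] a factor
    [N], and [a] and [b] harmonic sums. *)
Lemma sum_line_mass :
  \sum_(mu | mu != 0) line_mass mu <=
  4 * N%:R ^+ 2 * harmonic_sum R (2 * N) * harmonic_sum R (N ^ 2).
Proof.
rewrite (exchange_big_dep line_dvd) /=; last by move=> mu x _ /andP [].
apply: (@le_trans _ _ (\sum_(x | line_dvd x) line_weight x)).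
  apply: ler_sum => x x_dvd; rewrite sumr_const -[leRHS]mulr1n.
  rewrite ler_wpMn2l ?line_weight_ge0 //; apply: leq_trans (card_line_slope x).
  apply: subset_leq_card; apply/subsetP => mu.
  by rewrite unfold_in in_set => /and3P [].
rewrite big_mkcond /=; set w := fun x => if line_dvd x then line_weight x else 0.
have -> : \sum_x w x = \sum_a \sum_b \sum_g \sum_s w (a, b, g, s).
  by rewrite !pair_bigA; apply: eq_bigr => -[[[a b] g] s].
rewrite exchange_big /=; set H := harmonic_sum R (N ^ 2).
have -> : 4 * N%:R ^+ 2 * harmonic_sum R (2 * N) * H =
   \sum_(b < 2 * N) \sum_(g < N) (4 * N%:R / b.+1%:R * H).
  transitivity (\sum_(b < 2 * N) (4 * N%:R ^+ 2 * H) * b.+1%:R^-1).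
    by rewrite -mulr_sumr -/(harmonic_sum _ _); ring.
  by apply: eq_bigr => b _; rewrite sumr_const card_ord -mulr_natr; ring.
apply: ler_sum => b _; rewrite exchange_big /=; apply: ler_sum => g _.
apply: le_trans (ler_wpM2l _ (sum_square_multiples (ltn0Sn g))); last first.
  by rewrite divr_ge0 ?mulr_ge0 ?ler0n.
rewrite mulr_sumr [leRHS]big_mkcond /=; apply: ler_sum => a _.
rewrite /w /= sumr_const card_bool; case: ifP; rewrite ?mul0rn // => _.
rewrite le_eqVlt; apply/orP; left; apply/eqP; rewrite natrM; field.
by rewrite ?natr1 ?nat1r !pnatr_eq0.
Qed.

(** [Y] stands for [N^(3/2) / q^(1/2)]. In the first case of [card_curve_cases] the curve has at
    most [max (4, 22 T Y)] points; in the second, [m^2 <= line_mass mu]. *)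
Lemma sqr_card_curve_le (mu : 'F_q) (Y : R) : mu != 0 -> (0 < T)%N ->
  0 <= Y -> N%:R ^+ 3 = Y ^+ 2 * q%:R ->
  #|curve N mu|%:R ^+ 2 <=
    (4 + 22 * T%:R * Y + 8 * T%:R ^+ 2) * #|curve N mu|%:R +
    8 * T%:R ^+ 2 * line_mass mu.
Proof.
move=> mu_neq0 T_gt0 Y_ge0 Y2.
have mass_ge0 := line_mass_ge0 mu.
have T_ge1 : 1 <= T%:R :> R by rewrite ler1n.
have q_gt0 : 0 < q%:R :> R by rewrite ltr0n prime_gt0.
have [[K Kq PK]|[a [b [g [m [[a0 b0 a_le b_le ab] [g_dvd m_le P_le]]]]]]] :=
  card_curve_cases q_pr N_gt0 N_lt mu_neq0 T_bound.
  have {}Kq : K%:R <= 120 * Y ^+ 2.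
    rewrite -(ler_pM2r q_gt0) -mulrA -Y2 -natrX -!natrM ler_nat.
    exact: Kq.
  have {}PK : #|curve N mu|%:R ^+ 2 <= 2 * #|curve N mu|%:R + 2 * T%:R * K%:R :> R.
    by rewrite -natrX -!natrM -natrD ler_nat.
  move: PK; set p : R := #|curve N mu|%:R; set t : R := T%:R => PK.
  have p_ge0 : 0 <= p by rewrite ler0n.
  have t_ge0 : 0 <= t by rewrite ler0n.
  (* If [p > 4] then [2p <= p^2 / 2], so [p^2 <= 4 t K <= 480 t^2 Y^2], and [480 < 22^2]. *)
  suff p_le : (p <= 4) || (p <= 22 * t * Y).
    have p2_le : p ^+ 2 <= (4 + 22 * t * Y) * p.
      have tYp_ge0 : 0 <= t * Y * p by rewrite !mulr_ge0.
      rewrite mulrDl expr2; case/orP: p_le => p_le.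
        by have := ler_wpM2r p_ge0 p_le; lra.
      by have := ler_wpM2r p_ge0 p_le; lra.
    have : 0 <= 8 * t ^+ 2 * p by rewrite !mulr_ge0 ?exprn_ge0.
    have : 0 <= 8 * t ^+ 2 * line_mass mu by rewrite !mulr_ge0 ?exprn_ge0.
    by lra.
  case: leP => //= p_gt4; rewrite leNgt; apply/negP => p_gt.
  have tY_ge0 : 0 <= 22 * t * Y by rewrite !mulr_ge0.
  have : (22 * t * Y) ^+ 2 < p ^+ 2 by rewrite ltrXn2r ?nnegrE.
  have : t * K%:R <= t * (120 * Y ^+ 2) by rewrite ler_wpM2l.
  have : t * (480 * Y ^+ 2) <= t ^+ 2 * (480 * Y ^+ 2).
    by rewrite ler_wpM2r ?mulr_ge0 ?exprn_ge0 // expr2 ler_peMl.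
  have : 4 * p <= p ^+ 2 by rewrite expr2 ler_wpM2r // ltW.
  have : 0 <= t ^+ 2 * Y ^+ 2 by rewrite mulr_ge0 ?exprn_ge0.
  by rewrite !exprMn; lra.
move: P_le; have [->|P_gt0] := posnP #|curve N mu|.
  by move=> _; rewrite expr0n mulr0 add0r mulr_ge0 ?mulr_ge0 ?exprn_ge0 ?ler0n.
move=> P_le.
have mass_ge : m%:R ^+ 2 <= line_mass mu.
  have a_gt0 : (0 < `|a|)%N by rewrite absz_gt0.
  have b_gt0 : (0 < `|b|)%N by rewrite absz_gt0.
  have g_gt0 : (0 < g)%N by rewrite lt0n; apply: contraTneq g_dvd => ->; rewrite -lt0n.
  have g_le : (g <= N)%N.
    by rewrite -(leq_exp2r _ _ (isT : (0 < 2)%N)); apply: leq_trans (dvdn_leq a_gt0 g_dvd) a_le.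
  have a_lt : (`|a|.-1 < N ^ 2)%N by rewrite prednK.
  have b_lt : (`|b|.-1 < 2 * N)%N by rewrite prednK.
  have g_lt : (g.-1 < N)%N by rewrite prednK.
  (* The weight of this single index is already at least [m^2]. *)
  pose x : I := (Ordinal a_lt, Ordinal b_lt, Ordinal g_lt, (a < 0) (+) (b < 0)).
  have x_in : line_dvd x && line_slope mu x.
    rewrite /= !prednK // g_dvd /=; move: ab; rewrite {1}[a]intEsign {1}[b]intEsign.
    rewrite !intrM !rmorph_sign /= => ab; rewrite signr_addb mulrAC.
    by rewrite ab; apply/eqP; case: (b < 0); rewrite ?expr0 ?expr1; ring.
  rewrite /line_mass (bigD1 x) //=; apply: (@le_trans _ _ (line_weight x)); last first.
    by rewrite lerDl; apply: sumr_ge0 => y _; apply: line_weight_ge0.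
  rewrite /= !prednK // ler_pdivlMr ?mulr_gt0 ?ltr0n //.
  by rewrite -!natrX -!natrM ler_nat.
have P_ge1 : 1 <= #|curve N mu|%:R :> R by rewrite ler1n.
have {}P_le : #|curve N mu|%:R <= 2 * T%:R * (m%:R + 1) :> R.
  by rewrite natr1 -!natrM ler_nat.
move: P_le P_ge1; set p : R := #|curve N mu|%:R; set t : R := T%:R => P_le P_ge1.
have t_ge0 : 0 <= t by rewrite ler0n.
have p_ge0 : 0 <= p by rewrite ler0n.
have : p ^+ 2 <= (2 * t * (m%:R + 1)) ^+ 2.
  by rewrite lerXn2r ?nnegrE // !mulr_ge0 ?addr_ge0.
(* [(m + 1)^2 <= 2 (m^2 + 1)], and [1 <= p] because the curve is nonempty. *)
have : t ^+ 2 * (m%:R + 1) ^+ 2 <= t ^+ 2 * (2 * (p + line_mass mu)).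
  apply: ler_wpM2l; rewrite ?exprn_ge0 //.
  by have := sqr_ge0 (m%:R - 1 : R); nra.
have : 0 <= t * Y * p by rewrite !mulr_ge0.
by rewrite !exprMn; nra.
Qed.

End CurveSum.

(** * The two ranges of [q] and the final constants *)

Lemma sqr_natr_powR_ratio (R : realType) (N q : nat) : (0 < q)%N ->
  N%:R ^+ 3 = (N%:R `^ (3 / 2) / q%:R `^ (1 / 2)) ^+ 2 * q%:R :> R.
Proof.
move=> q_gt0; have q_neq0 : q%:R != 0 :> R by rewrite pnatr_eq0 -lt0n.
rewrite exprMn exprVn -!powR_mulrn ?powR_ge0 ?ler0n // -!powRrM.
have -> : 3 / 2 * 2%:R = 3%:R :> R by field.
have -> : 1 / 2 * 2%:R = 1 :> R by field.
by rewrite powRr1 ?ler0n // divfK.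
Qed.

Section EnergyBound.

Variables (R : realType) (q N T : nat) (j : 'F_q).
Hypotheses (q_pr : prime q) (N_gt0 : (0 < N)%N) (j_neq0 : j != 0).
Hypothesis T_bound : forall n : nat, (0 < n <= N ^ 2)%N -> (size (divisors n) <= T)%N.

Let Y : R := N%:R `^ (3 / 2) / q%:R `^ (1 / 2).

Let Y_ge0 : 0 <= Y.
Proof. by rewrite divr_ge0 ?powR_ge0. Qed.

(** [N^3 = Y^2 q <= 4 N Y^2] gives [N <= 2 Y], so the trivial bound [8 N^3] is enough. *)
Lemma T22_le_large : (q <= 4 * N)%N -> (T22 N j)%:R <= 16 * (Y * N%:R ^+ 2).
Proof.
move=> q_le; have Y2 := sqr_natr_powR_ratio R N (prime_gt0 q_pr).
have N_gt0R : 0 < N%:R :> R by rewrite ltr0n.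
have Y2_ge0 : 0 <= 2 * Y by apply: mulr_ge0; rewrite ?Y_ge0.
have N_le : N%:R <= 2 * Y.
  rewrite -(ler_pXn2r (isT : (0 < 2)%N)) ?nnegrE ?ler0n //.
  rewrite -(ler_pM2r N_gt0R) -exprSr Y2 -/Y.
  have : q%:R <= 4 * N%:R :> R by rewrite -natrM ler_nat.
  by move=> /(ler_wpM2l (exprn_ge0 2 Y_ge0)); lra.
have : (T22 N j)%:R <= 8 * N%:R ^+ 3 :> R.
  have -> : 8 = 2%:R ^+ 3 :> R by ring.
  by rewrite -exprMn -natrM -natrX ler_nat; apply: T22_le_cube.
have := ler_wpM2r (exprn_ge0 2 (ltW N_gt0R)) N_le; rewrite exprS; lra.
Qed.

Lemma T22_le_small (H : R) : (4 * N < q)%N -> 1 <= H ->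
  harmonic_sum R (2 * N) <= H -> harmonic_sum R (N ^ 2) <= H ->
  (T22 N j)%:R <= 204 * (T%:R ^+ 2 * H ^+ 2) * ((Y + 1) * N%:R ^+ 2).
Proof.
move=> N_lt H_ge1 H1 H2.
have T_gt0 : (0 < T)%N.
  by apply: leq_trans (T_bound (n := 1) _); rewrite // expn_gt0 N_gt0.
set t : R := T%:R; have t_ge1 : 1 <= t by rewrite ler1n.
set S := (\sum_(mu : 'F_q | mu != 0%R) #|curve N mu| ^ 2)%N.
set n2 : R := N%:R ^+ 2; have n2_ge0 : 0 <= n2 by rewrite exprn_ge0.
have T22_S : (T22 N j)%:R <= 4 * n2 + 2 * S%:R :> R.
  by rewrite /n2 -natrX -!natrM -natrD ler_nat T22_le_curve.
pose A : R := 4 + 22 * t * Y + 8 * t ^+ 2.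
have t_ge0 : 0 <= t by rewrite ler0n.
have sum_P : \sum_(mu : 'F_q | mu != 0) (#|curve N mu|%:R : R) <= 2 * n2.
  rewrite /n2 -natrX -natrM -natr_sum ler_nat; apply: leq_trans _ (sum_card_curve q N).
  by rewrite [leqRHS](bigID (fun mu => mu != 0)) /= leq_addr.
have S_le : S%:R <= A * (2 * n2) + 8 * t ^+ 2 * (4 * n2 * H ^+ 2).
  rewrite natr_sum; under eq_bigr do rewrite natrX.
  apply: (@le_trans _ _ (\sum_(mu : 'F_q | mu != 0)
    (A * #|curve N mu|%:R + 8 * t ^+ 2 * line_mass R N mu))).
    apply: ler_sum => mu mu_neq0.
    exact: (sqr_card_curve_le q_pr N_gt0 N_lt T_bound mu_neq0 T_gt0 Y_ge0
              (sqr_natr_powR_ratio R N (prime_gt0 q_pr))).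
  have tY_ge0 : 0 <= t * Y by apply: mulr_ge0.
  have t2_ge0 : 0 <= t ^+ 2 by apply: exprn_ge0.
  rewrite big_split /= -!mulr_sumr.
  apply: lerD; apply: ler_wpM2l => //; rewrite /A; try lra.
  apply: le_trans (sum_line_mass R q_pr N_gt0 N_lt) _.
  rewrite -/n2 -[leLHS]mulrA ler_wpM2l ?mulr_ge0 //.
  by rewrite expr2 ler_pM ?harmonic_sum_ge0.
have HH : 1 <= H ^+ 2 by rewrite exprn_ege1.
have tt : t <= t ^+ 2 by rewrite expr2 ler_peMl //; lra.
set w := t ^+ 2 * H ^+ 2; set Z := Y + 1.
have Z_ge1 : 1 <= Z by rewrite lerDr.
have t2_ge1 : 1 <= t ^+ 2 by rewrite exprn_ege1.
have t2_le_w : t ^+ 2 <= w by rewrite ler_peMr //; lra.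
have w_le : w <= w * Z by rewrite ler_peMr //; lra.
have t2Z_le : t ^+ 2 * Z <= w * Z by rewrite ler_wpM2r //; lra.
have A_le : A <= 34 * (t ^+ 2 * Z).
  have : t * Y <= t ^+ 2 * Y by rewrite ler_wpM2r.
  have : 0 <= t ^+ 2 * Y by rewrite mulr_ge0 // exprn_ge0; lra.
  by rewrite /A /Z; lra.
(* [204 = 4 + 4 * 34 + 64], every term being compared with [w * Z]. *)
have : n2 * (4 + 4 * A + 64 * w) <= n2 * (204 * (w * Z)).
  by rewrite ler_wpM2l //; lra.
by rewrite /w in S_le *; lra.
Qed.

End EnergyBound.

(** [T] is the largest divisor count up to [N^2], attained at some integer of that range, whence the
    square of [N^e]. *)
Lemma divisor_count_bound (R : realType) (e : R) : 0 < e ->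
  exists2 C : R, 0 < C & forall N : nat, (0 < N)%N -> exists2 T : nat,
    (forall n : nat, (0 < n <= N ^ 2)%N -> (size (divisors n) <= T)%N) &
    T%:R <= C * (N%:R `^ e) ^+ 2.
Proof.
move=> e_gt0; have [C C_gt0 C_bound] := size_divisors_le e_gt0; exists C => // N N_gt0.
have card_gt0 : (0 < #|'I_(N ^ 2)|)%N by rewrite card_ord expn_gt0 N_gt0.
have [k kE] := bigop.eq_bigmax (fun k : 'I_(N ^ 2) => size (divisors k.+1)) card_gt0.
exists (\max_(k < N ^ 2) size (divisors k.+1)).
  case=> // n n_lt.
  exact: (leq_bigmax (F := fun k : 'I_(N ^ 2) => size (divisors k.+1)) (Ordinal n_lt)).
rewrite kE; apply: le_trans (C_bound _ (ltn0Sn _)) _; rewrite ler_pM2l //.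
by rewrite -powR_natX ge0_ler_powR ?nnegrE ?ler0n ?ler_nat ?ltW.
Qed.

Theorem theorem1p1 (R : realType) (eps : R) (eps_gt0 : 0 < eps) :
  exists2 C : R, 0 < C &
    forall (q : nat) (j : 'F_q) (N : nat),
      prime q -> j != 0 -> (0 < N <= q)%N ->
      (T22 N j)%:R <=
        C * ((N%:R `^ (3 / 2) / q%:R `^ (1 / 2) + 1) * N%:R `^ (2 + eps)).
Proof.
(* With [X = N^e], both [T] and the harmonic sums are [O(X^2)] and both enter squared, for a total
   of [X^8 = N^eps]. *)
pose e := eps / 8; have e_gt0 : 0 < e by rewrite /e; lra.
have [C1 C1_gt0 T_exists] := divisor_count_bound e_gt0.
(* The factor [2^e] lets one bound cover both lengths [2N] and [N^2], which are at most [2 N^2]. *)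
pose C2 := (1 + e^-1) * 2%:R `^ e.
have C2_gt0 : 0 < C2.
  by rewrite mulr_gt0 ?powR_gt0 ?ltr0n // addr_gt0 ?invr_gt0.
(* [16] serves the range [q <= 4 N], the other term the range [4 N < q]. *)
exists (16 + 204 * (C1 ^+ 2 * C2 ^+ 2)).
  have : 0 < C1 ^+ 2 * C2 ^+ 2 by apply: mulr_gt0; apply: exprn_gt0.
  by lra.
move=> q j N q_pr j_neq0 /andP [N_gt0 N_le_q].
set Y := N%:R `^ _ / _; set X := N%:R `^ e.
have X_ge1 : 1 <= X by apply: powR_nat_ge1 => //; apply: ltW.
have NE : N%:R `^ (2 + eps) = N%:R ^+ 2 * X ^+ 8.
  rewrite powRD; last by rewrite pnatr_eq0 -lt0n N_gt0 implybT.
  rewrite powR_mulrn ?ler0n // -(powR_mulrn 8) ?powR_ge0 // -powRrM.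
  by congr (_ * _ `^ _); rewrite /e; field.
have Y_ge0 : 0 <= Y by rewrite divr_ge0 ?powR_ge0.
set n2 := N%:R ^+ 2 in NE *; have n2_ge0 : 0 <= n2 by rewrite exprn_ge0.
have X8_ge1 : 1 <= X ^+ 8 by rewrite exprn_ege1.
pose B := (Y + 1) * n2; have B_ge0 : 0 <= B by rewrite mulr_ge0 // addr_ge0.
have B_le : B <= B * X ^+ 8 by rewrite ler_peMr.
pose w := C1 ^+ 2 * C2 ^+ 2; have w_ge0 : 0 <= w by rewrite mulr_ge0 ?exprn_ge0 // ltW.
have wB_ge0 : 0 <= w * (B * X ^+ 8) by rewrite mulr_ge0 //; lra.
rewrite NE -/w.
have -> : (16 + 204 * w) * ((Y + 1) * (n2 * X ^+ 8)) =
    16 * (B * X ^+ 8) + 204 * (w * (B * X ^+ 8)) by rewrite /B; ring.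
have [q_le|q_gt] := leqP q (4 * N).
  have := T22_le_large R j q_pr N_gt0 q_le; rewrite -/Y -/n2 => T22_le.
  have : Y * n2 <= B by rewrite /B ler_wpM2r // lerDl.
  by lra.
have [T T_bound T_le] := T_exists N N_gt0.
have H_bound n : (0 < n <= 2 * N ^ 2)%N -> harmonic_sum R n <= C2 * X ^+ 2.
  move=> /andP [n_gt0 n_le]; apply: le_trans (harmonic_sum_le e_gt0 n_gt0) _.
  rewrite -mulrA ler_pM2l ?addr_gt0 ?invr_gt0 // -powR_natX -powRM ?ler0n // -natrM.
  by rewrite ge0_ler_powR ?nnegrE ?ler0n ?ler_nat // ltW.
have H_ge1 : 1 <= C2 * X ^+ 2.
  rewrite mulr_ege1 ?exprn_ege1 // mulr_ege1 ?lerDl ?invr_ge0 ?(ltW e_gt0) //.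
  by apply: powR_nat_ge1; rewrite ?ltW.
have T22_le : (T22 N j)%:R <= 204 * (T%:R ^+ 2 * (C2 * X ^+ 2) ^+ 2) * B.
  apply: (T22_le_small q_pr N_gt0 j_neq0 T_bound q_gt H_ge1); apply: H_bound.
    by rewrite muln_gt0 N_gt0 leq_mul2l -mulnn leq_pmulr.
  by rewrite expn_gt0 N_gt0 leq_pmull.
have : T%:R ^+ 2 * (C2 * X ^+ 2) ^+ 2 <= w * X ^+ 8.
  have -> : w * X ^+ 8 = (C1 * X ^+ 2) ^+ 2 * (C2 * X ^+ 2) ^+ 2 by rewrite /w; ring.
  rewrite ler_wpM2r ?sqr_ge0 // lerXn2r ?nnegrE ?ler0n //.
  by apply: le_trans T_le.
by move=> /(ler_wpM2r B_ge0); lra.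
Qed.
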